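(* Let $K$ be an algebraically closed field, let $n$ be a positive integer, and let $f_1,\ldots,f_r \in K[x] = K[x_1,\ldots,x_{n^2}]$ with $I = (f_1,\ldots,f_r)$. The algorithm that, for each $1 \le i \le r$, performs the three checks below, returns false as soon as one of them fails, and returns true otherwise, correctly decides whether $V^*(I)$ is a group under matrix multiplication (that is, a subgroup of $GL(n,K)$). Equivalently, $V^*(I)$ is a group under matrix multiplication if and only if for every $1 \le i \le r$ all of the following hold: (1) $f_i(1_n) = 0$, where $1_n$ is the $n\times n$ identity matrix; (2) $f_i(N(x)) \in \sqrt{\hat{I}}$; (3) $f_i(xy) \in \sqrt{\hat{I}_{xy}}$.
   Context: Vectors in $K^{n^2}$ are identified with $n\times n$ matrices by writing the entries row by row: $(v_1,\ldots,v_{n^2})$ corresponds to the matrix with first row $v_1,\ldots,v_n$ and last row $v_{n^2-n+1},\ldots,v_{n^2}$. Thus a polynomial in $n^2$ variables can be evaluated at an $n \times n$ matrix over any commutative $K$-algebra, and the list of indeterminates $x=(x_1,\ldots,x_{n^2})$ is also regarded as an $n\times n$ matrix, so that $\det(x)\in K[x]$. $V(I) = \{v \in K^{n\times n} \mid f_1(v)=\cdots=f_r(v)=0\}$ and $V^*(I) = V(I)\cap GL(n,K)$. Let $x_0$ be a further indeterminate, $\hat{x} = (x_0,x_1,\ldots,x_{n^2})$, $f_0 = x_0\det(x)-1 \in K[\hat{x}]$, and let $\hat{I} = I+(f_0)$ be the ideal of $K[\hat{x}]$ generated by $f_1,\ldots,f_r,f_0$. Let $y = (y_1,\ldots,y_{n^2})$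 and $\hat{y}=(y_0,y_1,\ldots,y_{n^2})$ be further indeterminates (with $y$ also regarded as an $n\times n$ matrix), let $\varphi: K[\hat{x}]\to K[\hat{y}]$ be the $K$-algebra homomorphism with $x_i\mapsto y_i$ for $0\le i\le n^2$, and let $\hat{I}_{xy} = \hat{I}+\varphi(\hat{I})$ be the ideal of $K[\hat{x},\hat{y}]$ generated by $\hat{I}$ and $\varphi(\hat{I})$. In $f_i(xy)$, $xy$ denotes the product of the matrices $x$ and $y$, so $f_i(xy) \in K[x,y]\subseteq K[\hat{x},\hat{y}]$. $N(x)$ denotes the formal inverse of the matrix $x$, i.e. the classical adjoint of $x$ divided by $\det(x)$. In condition (2), $1/\det(x)$ is represented by $x_0$: $f_i(N(x))$ means the polynomial in $K[\hat{x}]$ obtained by evaluating $f_i$ at the matrix $x_0\,\mathrm{adj}(x)$, where $\mathrm{adj}(x)$ is the classical adjoint of $x$. $\sqrt{\cdot}$ denotes the radical of an ideal. *)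

(* Defs.v *)
From mathcomp Require Import all_boot all_order all_algebra.
From mathcomp Require Import mpoly.

Set Implicit Arguments.
Unset Strict Implicit.
Unset Printing Implicit Defensive.

Import GRing.Theory.
Local Open Scope ring_scope.

(* Ideals and radicals as Prop-valued sets: membership in an ideal is not      *)
(* given by a boolean predicate over a general ring.                           *)
Section Ideals.
Variable R : comNzRingType.

Definition ideal_gen (S : R -> Prop) (p : R) : Prop :=
  exists (m : nat) (c s : 'I_m -> R),
    (forall k, S (s k)) /\ p = \sum_(k < m) c k * s k.

Definition radical (I : R -> Prop) (p : R) : Prop :=
  exists2 m : nat, (0 < m)%N & I (p ^+ m).

End Ideals.

(* An n x n matrix is identified with a vector of length n * n by mxvec, which *)
(* lists the entries row by row; mxvec_index i j is the position of (i, j).    *)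
Section MatrixVariety.
Variables (K : fieldType) (n r : nat).

Definition eval_mx (f : {mpoly K[n * n]}) (A : 'M[K]_n) : K :=
  f.@[fun k => mxvec A 0 k].

Definition subst_mx (N : nat) (f : {mpoly K[n * n]})
    (M : 'M[{mpoly K[N]}]_n) : {mpoly K[N]} :=
  f \mPo [tuple mxvec M 0 k | k < n * n].

Variable f : 'I_r -> {mpoly K[n * n]}.

Definition V (A : 'M[K]_n) : Prop := forall i, eval_mx (f i) A = 0.

Definition Vstar (A : 'M[K]_n) : Prop := V A /\ A \in unitmx.

Definition is_subgroup_GL (S : 'M[K]_n -> Prop) : Prop :=
  [/\ forall A, S A -> A \in unitmx,
      S 1%:M,
      forall A B, S A -> S B -> S (A *m B)
    & forall A, S A -> S (invmx A)].

(* K[xhat] is {mpoly K[nhat]}: the variable 0 is x_0, and the variable k + 1   *)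
(* is the k-th (from 0) entry of the matrix x.                                 *)
Definition nhat : nat := (n * n).+1.

Definition x0 : {mpoly K[nhat]} := 'X_ord0.

Definition xmx : 'M[{mpoly K[nhat]}]_n :=
  \matrix_(i, j) 'X_(lift ord0 (mxvec_index i j)).

Definition f0 : {mpoly K[nhat]} := x0 * \det xmx - 1.

(* subst_mx (f i) xmx is f_i viewed in K[xhat]. *)
Definition Ihat : {mpoly K[nhat]} -> Prop :=
  ideal_gen (fun q => (exists i, q = subst_mx (f i) xmx) \/ q = f0).

Definition Nmx : 'M[{mpoly K[nhat]}]_n := x0 *: \adj xmx.

(* K[xhat, yhat] is {mpoly K[nhat + nhat]}, with the variables xhat first.     *)
(* in_x is the inclusion of K[xhat], and in_y is phi followed by the inclusion *)
(* of K[yhat].                                                                 *)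
Definition in_x (p : {mpoly K[nhat]}) : {mpoly K[nhat + nhat]} :=
  p \mPo [tuple 'X_(lshift nhat k) | k < nhat].

Definition in_y (p : {mpoly K[nhat]}) : {mpoly K[nhat + nhat]} :=
  p \mPo [tuple 'X_(rshift nhat k) | k < nhat].

Definition Ihat_xy : {mpoly K[nhat + nhat]} -> Prop :=
  ideal_gen (fun q => exists2 p, Ihat p & q = in_x p \/ q = in_y p).

Definition xymx : 'M[{mpoly K[nhat + nhat]}]_n :=
  map_mx in_x xmx *m map_mx in_y xmx.

(* The algorithm, relative to subroutines deciding membership in the radicals  *)
(* of Ihat and of Ihat_xy.                                                     *)
Section Algorithm.
Variables (in_rad_hat : {mpoly K[nhat]} -> bool)
          (in_rad_xy : {mpoly K[nhat + nhat]} -> bool).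

Fixpoint check_loop (s : seq 'I_r) : bool :=
  if s is i :: s' then
    if eval_mx (f i) 1%:M != 0 then false
    else if ~~ in_rad_hat (subst_mx (f i) Nmx) then false
    else if ~~ in_rad_xy (subst_mx (f i) xymx) then false
    else check_loop s'
  else true.

Definition group_test : bool := check_loop (enum 'I_r).

End Algorithm.

End MatrixVariety.

(* Main.v *)
Require Import Defs.
From HB Require Import structures.
From mathcomp Require Import all_boot all_order all_algebra.
From mathcomp Require Import mpoly.
From mathcomp Require boolp classical_sets.

Set Implicit Arguments.
Unset Strict Implicit.
Unset Printing Implicit Defensive.

Import GRing.Theory.
Local Open Scope ring_scope.

(* By Hilbert's Nullstellensatz, membership in the two radicals means         *)
(* vanishing on [V*(I)] and on [V*(I) x V*(I)], since the zeros of [Ihat] are *)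
(* the pairs [(1 / det A, A)] with [A] in [V*(I)]. The Nullstellensatz needs  *)
(* no normalization: if no power of [g] is in an ideal, Zorn's lemma gives a  *)
(* prime [Q] containing the ideal but not [g], and a zero of [Q] where [g]    *)
(* does not vanish is found one variable at a time: a zero of the contraction *)
(* of [Q] to one variable less extends as soon as some polynomial [a] outside *)
(* the contraction does not vanish there.                                     *)

(** The group axioms for [Vstar f] say that certain polynomials vanish at certain points. A zero of
    [Ihat] is a matrix A of [Vstar f] together with $x_0 = 1/\det A$ ([meval_Ihat], [Vstar_Vhat]),
    and there [Nmx] evaluates to the inverse of A ([map_Nmx]). So closure under inverses says that
    each $f_i(N(x))$ vanishes at all zeros of [Ihat]; closure under products says that each
    $f_i(xy)$ vanishes at all zeros of [Ihat_xy], which are the pairs of such points.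
    [nullstellensatz] turns vanishing into radical membership, and evaluation gives the converse.
    With $f_i(1_n) = 0$ this is [subgroup_GL_VstarP].

    The Nullstellensatz combines [prime_ideal_avoiding] with [prime_ideal_point], whose inductive
    step is [prime_ideal_extension]. Over the fraction field of the coefficients modulo the
    contraction, the prime ideal becomes zero or is generated by one irreducible h. In the first
    case the last coordinate is any nonroot of g; in the second it is a root of h, where g, being
    coprime to h, does not vanish. Pseudo-division carries this out without forming the fraction
    field. *)

Record is_ideal (R : nzRingType) (I : R -> Prop) : Prop := IsIdeal {
  ideal0 : I 0;
  idealD : forall x y, I x -> I y -> I (x + y);
  idealMl : forall c x, I x -> I (c * x)
}.

Record is_prime_ideal (R : nzRingType) (I : R -> Prop) : Prop := IsPrimeIdeal {
  prime_ideal : is_ideal I;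
  prime_ideal1 : ~ I 1;
  prime_idealM : forall x y, I (x * y) -> I x \/ I y
}.

(** * Ideals, and prime ideals avoiding the powers of an element *)

Section IdealTheory.
Variable R : comNzRingType.
Implicit Type I : R -> Prop.

Lemma idealN I x : is_ideal I -> I x -> I (- x).
Proof. by move=> idI Ix; rewrite -mulN1r; apply: idealMl. Qed.

Lemma idealB I x y : is_ideal I -> I x -> I y -> I (x - y).
Proof. by move=> idI Ix Iy; apply: idealD => //; apply: idealN. Qed.

Lemma ideal_sum I m (F : 'I_m -> R) :
  is_ideal I -> (forall k, I (F k)) -> I (\sum_k F k).
Proof.
move=> idI IF; apply: big_ind => [|x y|k _]; first exact: ideal0.
  exact: idealD.
exact: IF.
Qed.

Lemma prime_idealX I x m : is_prime_ideal I -> I (x ^+ m) -> I x.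
Proof.
move=> prI; elim: m => [|m IHm]; first by rewrite expr0 => /(prime_ideal1 prI).
by rewrite exprS => /(prime_idealM prI)[].
Qed.

Lemma ideal_gen_ideal (S : R -> Prop) : is_ideal (ideal_gen S).
Proof.
split.
- exists 0, (fun=> 0), (fun=> 0); split; first by case.
  by rewrite big_ord0.
- move=> _ _ [m1 [c1 [s1 [S1 ->]]]] [m2 [c2 [s2 [S2 ->]]]].
  pose glue T (u : 'I_m1 -> T) (v : 'I_m2 -> T) k :=
    match split k with inl i => u i | inr j => v j end.
  exists (m1 + m2)%N, (glue R c1 c2), (glue R s1 s2); split.
    by move=> k; rewrite /glue; case: split.
  rewrite big_split_ord /=; congr (_ + _); apply: eq_bigr => k _.
    by rewrite /glue (unsplitK (inl k)).
  by rewrite /glue (unsplitK (inr k)).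
- move=> a _ [m [c [s [Ss ->]]]]; exists m, (fun k => a * c k), s; split=> //.
  by rewrite mulr_sumr; apply: eq_bigr => k _; rewrite mulrA.
Qed.

Lemma mem_ideal_gen (S : R -> Prop) x : S x -> ideal_gen S x.
Proof.
by move=> Sx; exists 1, (fun=> 1), (fun=> x); rewrite big_ord1 mul1r.
Qed.

Lemma ideal_gen_sub (S I : R -> Prop) :
  is_ideal I -> (forall x, S x -> I x) -> forall x, ideal_gen S x -> I x.
Proof.
move=> idI SI _ [m [c [s [Ss ->]]]].
by apply: ideal_sum => // k; apply: idealMl => //; apply: SI.
Qed.

Definition adjoin_ideal I (g : R) : R -> Prop :=
  fun x => exists2 a, I a & exists c, x = a + c * g.

Lemma adjoin_ideal_ideal I g : is_ideal I -> is_ideal (adjoin_ideal I g).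
Proof.
move=> idI; split.
- by exists 0; [exact: ideal0 | exists 0; rewrite mul0r addr0].
- move=> _ _ [a Ia [c ->]] [b Ib [d ->]]; exists (a + b); first exact: idealD.
  by exists (c + d); rewrite mulrDl addrACA.
- move=> e _ [a Ia [c ->]]; exists (e * a); first exact: idealMl.
  by exists (e * c); rewrite mulrDr mulrA.
Qed.

Lemma sub_adjoin_ideal I g x : I x -> adjoin_ideal I g x.
Proof. by move=> Ix; exists x => //; exists 0; rewrite mul0r addr0. Qed.

Lemma mem_adjoin_ideal I g : is_ideal I -> adjoin_ideal I g g.
Proof.
by move=> idI; exists 0; [exact: ideal0 | exists 1; rewrite mul1r add0r].
Qed.

(** An ideal maximal among those containing [I] and no power of [g] is prime: if it misses both x
    and y, adjoining either one captures a power of [g], and the product of these two powers lies in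
    the ideal as soon as xy does. *)
Lemma prime_ideal_avoiding I g :
    is_ideal I -> (forall m, ~ I (g ^+ m)) ->
  exists Q, [/\ is_prime_ideal Q, forall x, I x -> Q x & ~ Q g].
Proof.
move=> idI avI.
(* The empty set is admitted so that the union of an empty chain is too. *)
pose P (X : R -> Prop) :=
  [/\ forall x, X x -> forall y, I y -> X y,
      forall x y, X x -> X y -> X (x + y),
      forall c x, X x -> X (c * x)
    & forall m, ~ X (g ^+ m)].
have PI J : is_ideal J -> (forall x, I x -> J x) -> (forall m, ~ J (g ^+ m)) ->
    P J.
  by move=> [J0 JD JM] IJ avJ; split=> // x _; apply: IJ.
have [F FP totF|A [PA maxA]] := @classical_sets.Zorn_bigcup R P.
  split.
  - move=> x [X FX Xx] y Iy; exists X => //.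
    by have [XI _ _ _] := FP X FX; apply: XI Xx y Iy.
  - move=> x y [X FX Xx] [Y FY Yy].
    have [_ XD _ _] := FP X FX; have [_ YD _ _] := FP Y FY.
    case: (totF X Y FX FY) => sXY.
      by exists Y => //; apply: YD => //; apply: sXY.
    by exists X => //; apply: XD => //; apply: sXY.
  - move=> c x [X FX Xx]; have [_ _ XM _] := FP X FX.
    by exists X => //; apply: XM.
  - by move=> m [X FX Xg]; have [_ _ _ avX] := FP X FX; apply: avX Xg.
have [AI AD AM avA] := PA.
(* A maximal set is not empty, since [I] satisfies [P] and is strictly larger than the empty set. *)
have [x Ax] : exists x, A x.
  apply: boolp.contrapT => A0; apply: (maxA I); last exact: PI.
  split=> [x Ax|sIA]; first by case: A0; exists x.
  by apply: A0; exists 0; apply: sIA; apply: ideal0.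
have {x Ax} sIA y : I y -> A y by apply: AI Ax y.
have idA : is_ideal A by split=> //; apply: sIA; apply: ideal0.
have meets y : ~ A y -> exists m, adjoin_ideal A y (g ^+ m).
  move=> nAy; apply: boolp.contrapT => avy.
  apply: (maxA (adjoin_ideal A y)).
    split=> [x|sA]; first exact: sub_adjoin_ideal.
    by apply: nAy; apply: sA; apply: mem_adjoin_ideal.
  apply: PI => [|x Ix|m gm]; first exact: adjoin_ideal_ideal.
    by apply: sub_adjoin_ideal; apply: sIA.
  by apply: avy; exists m.
exists A; split=> //; last by rewrite -[g]expr1; apply: avA.
split=> // [|x y Axy]; first by rewrite -(expr0 g); apply: avA.
apply: boolp.contrapT => nAxy.
have [|m [a Aa [c gm]]] := meets x; first by move=> Ax; apply: nAxy; left.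
have [|k [b Ab [d gk]]] := meets y; first by move=> Ay; apply: nAxy; right.
apply: (avA (m + k)%N); rewrite exprD gm gk mulrDr [_ * (d * y)]mulrDl.
apply: (AD); first exact: AM.
apply: (AD); first by rewrite mulrC; apply: AM.
by rewrite mulrACA; apply: AM.
Qed.

End IdealTheory.

(** * Polynomials in one variable modulo an ideal of coefficients *)

Section PolyExtension.
Variable A : idomainType.
Implicit Types (I J : {poly A} -> Prop) (P : A -> Prop) (u w g h : {poly A}).

Lemma ideal_of_coefs J u :
  is_ideal J -> (forall i, J (u`_i)%:P) -> J u.
Proof.
move=> idJ Ju; rewrite -[u]coefK poly_def; apply: ideal_sum => // i.
by rewrite -mul_polyC mulrC; apply: idealMl.
Qed.

Lemma lead_coef_notin_neq0 P w : is_ideal P -> ~ P (lead_coef w) -> w != 0.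
Proof.
by move=> idP; apply: contra_notN => /eqP->; rewrite lead_coef0; apply: ideal0.
Qed.

(** Strong induction on the size: the leading term of [r] lies in [J] because its coefficient is in
    [P], so removing it leaves a shorter element of [J]. *)
Lemma coefs_of_lead_coefs J P d :
    is_ideal J -> is_ideal P -> (forall c, P c -> J c%:P) ->
    (forall r, J r -> (size r < d)%N -> P (lead_coef r)) ->
  forall r, J r -> (size r < d)%N -> forall i, P r`_i.
Proof.
move=> idJ idP sPJ Plead r.
have [m] := ubnP (size r); elim: m r => // m IHm r szr Jr ltrd i.
have [->|r_neq0] := eqVneq r 0; first by rewrite coef0; apply: ideal0.
have Plr := Plead r Jr ltrd.
pose n := (size r).-1; pose s := take_poly n r.
have szrE : size r = n.+1 by rewrite polySpred.
have rE : r = s + lead_coef r *: 'X^n.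
  apply/polyP=> j; rewrite coefD coef_take_poly coefZ coefXn lead_coefE -/n.
  case: (ltngtP j n) => [_|ltnj|->]; rewrite ?mulr0 ?addr0 ?mulr1 ?add0r //.
  by rewrite nth_default // szrE.
have szs : (size s < size r)%N by rewrite szrE ltnS size_take_poly.
have Js : J s.
  rewrite -(addrK (lead_coef r *: 'X^n) s) -rE; apply: idealB => //.
  by rewrite -mul_polyC mulrC; apply: idealMl => //; apply: sPJ.
rewrite rE coefD coefZ; apply: idealD => //; last first.
  by rewrite mulrC; apply: idealMl.
by apply: IHm => //; [apply: leq_trans szs _ | apply: ltn_trans szs _].
Qed.

(** For [P] prime, [w] plays the role of a generator of [J] over the fraction field of [A] modulo
    [P]: it has least size among the elements of [J] whose leading coefficient survives modulo
    [P]. *)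
Lemma minimal_lead_coef J P w0 :
    is_ideal J -> is_ideal P -> (forall c, P c -> J c%:P) ->
    J w0 -> ~ P (lead_coef w0) ->
  exists w, [/\ J w, ~ P (lead_coef w)
    & forall r, J r -> (size r < size w)%N -> forall i, P r`_i].
Proof.
move=> idJ idP sPJ Jw0 Pw0.
pose S d := exists w, [/\ J w, ~ P (lead_coef w) & size w = d].
have exS : exists d, boolp.asbool (S d).
  by exists (size w0); apply/boolp.asboolP; exists w0.
case: (ex_minnP exS) => d /boolp.asboolP[w [Jw Pw sz_w]] minw.
exists w; split=> //; apply: coefs_of_lead_coefs => // r Jr.
rewrite sz_w => szr.
apply: boolp.contrapT => nPr; move: szr; rewrite ltnNge minw //.
by apply/boolp.asboolP; exists r.
Qed.

(** The pseudo-remainder lies in [J] and is shorter than [w], so it vanishes modulo [P]. The bound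
    on the size of the quotient serves to compare it with [u] when [w] is not constant. *)
Lemma pseudo_division_mod J P w u :
    is_ideal J -> is_ideal P -> J w -> ~ P (lead_coef w) ->
    (forall r, J r -> (size r < size w)%N -> forall i, P r`_i) ->
    J u ->
  exists k (q : {poly A}), (size q <= size u - (size w).-1)%N /\
    forall i, P (lead_coef w ^+ k *: u - q * w)`_i.
Proof.
move=> idJ idP Jw Pw minw Ju; exists (scalp u w), (u %/ w).
have w_neq0 := lead_coef_notin_neq0 idP Pw.
split; first by rewrite size_divp.
rewrite Pdiv.Idomain.divp_eq addrC addKr; apply: minw; last by rewrite ltn_modp.
rewrite -[u %% w](addKr (u %/ w * w)) -Pdiv.Idomain.divp_eq addrC.
apply: idealB => //; last exact: idealMl.
by rewrite -mul_polyC; apply: idealMl.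
Qed.

(* Over the fraction field of [A / P], where [P] is the contraction of [I],   *)
(* the ideal [I] is generated by one polynomial; [a] clears the denominators  *)
(* of a Bezout relation between that generator and [g].                       *)
Lemma prime_ideal_extension (K : closedFieldType) I g :
    is_prime_ideal I -> ~ I g ->
  exists2 a, ~ I a%:P & forall e : {rmorphism A -> K},
    (forall c, I c%:P -> e c = 0) -> e a != 0 ->
    exists2 b, (map_poly e g).[b] != 0
             & forall u, I u -> (map_poly e u).[b] = 0.
Proof.
move=> prI nIg; have idI := prime_ideal prI.
pose P c := I c%:P.
have idP : is_ideal P.
  split=> [|x y Px Py|c x Px]; rewrite /P ?polyC0 ?polyCD ?polyCM.
  - exact: ideal0.
  - exact: idealD.
  - exact: idealMl.
have PM x y : P (x * y) -> P x \/ P y.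
  by rewrite /P polyCM; apply: prime_idealM.
have PX x k : P (x ^+ k) -> P x by rewrite /P polyC_exp; apply: prime_idealX.
(* The cases are whether [I] is nonzero or zero modulo [P]. *)
have [[h0 [Ih0 nPh0]]|noh] :=
  boolp.pselect (exists h, I h /\ ~ P (lead_coef h)).
- have [h [Ih nPh minh]] := minimal_lead_coef idI idP (fun c Pc => Pc) Ih0 nPh0.
  pose J := adjoin_ideal I g.
  have idJ : is_ideal J by apply: adjoin_ideal_ideal.
  have sIJ x : I x -> J x by apply: sub_adjoin_ideal.
  have [w [Jw nPw minw]] :=
    minimal_lead_coef idJ idP (fun c Pc => sIJ c%:P Pc) (sIJ h0 Ih0) nPh0.
  have coefsI u : (forall i, P u`_i) -> I u by apply: ideal_of_coefs.
  have divI u k q : J u -> (forall i, P (lead_coef w ^+ k *: u - q * w)`_i) ->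
      I w -> I u.
    move=> Ju Pr Iw; have : I (lead_coef w ^+ k *: u).
      rewrite -[X in I X](subrK (q * w)); apply: idealD => //.
        exact: coefsI.
      exact: idealMl.
    by rewrite -mul_polyC => /(prime_idealM prI)[/(PX _ _)/nPw|].
  have nIw : ~ I w.
    have Jg : J g by apply: mem_adjoin_ideal.
    have [k [q [szq Pr]]] := pseudo_division_mod idJ idP Jw nPw minw Jg.
    by move=> Iw; apply: nIg; apply: divI Jg Pr Iw.
  have w_neq0 := lead_coef_notin_neq0 idP nPw.
  (* [w] divides [h] modulo [P], up to a power of its leading coefficient. As [I] is prime and
     misses [w], the quotient is in [I]; were [w] not constant, the quotient would be shorter than
     [h], hence zero modulo [P], and so would the leading coefficient of [h]. *)
  have szw : size w = 1%N.
    have [k [q [szq Pr]]] := pseudo_division_mod idJ idP Jw nPw minw (sIJ h Ih).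
    have Iqw : I (q * w).
      rewrite -[q * w](subKr (lead_coef w ^+ k *: h)); apply: idealB => //.
        by rewrite -mul_polyC; apply: idealMl.
      exact: coefsI.
    have [Iq|//] := prime_idealM prI Iqw.
    apply/eqP; rewrite eqn_leq lt0n size_poly_eq0 w_neq0 andbT leqNgt.
    apply/negP=> szw; have szh : (0 < size h)%N.
      by rewrite lt0n size_poly_eq0; apply: lead_coef_notin_neq0 nPh.
    have Pq : forall i, P q`_i.
      apply: minh => //; apply: leq_ltn_trans szq _.
      by rewrite ltn_subrL szh andbT -ltnS prednK // (ltn_trans _ szw).
    have : P (lead_coef w ^+ k * lead_coef h).
      rewrite [lead_coef h]lead_coefE -coefZ.
      rewrite -[_ *: h](subrK (q * w)) coefD; apply: idealD => //.
      by rewrite coefM; apply: ideal_sum => // i; rewrite mulrC; apply: idealMl.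
    by case/PM => [/(PX _ _)/nPw|].
  have [a wE] : exists a, w = a%:P.
    by exists w`_0; apply: size1_polyC; rewrite szw.
  (* The factor [a] is a combination of [g] and an element of [I], so its nonvanishing keeps [g]
     from vanishing at [b]; the leading coefficient of [h] must survive for [h] to keep its degree,
     hence a root, and for pseudo-division by [h] to be cancelled. *)
  exists (a * lead_coef h) => [|e eP].
    by case/PM => // Pa; apply: nPw; rewrite wE lead_coefC.
  rewrite rmorphM mulf_eq0 negb_or => /andP[ea_neq0 eh_neq0].
  have mapP u : (forall i, P u`_i) -> map_poly e u = 0.
    by move=> Pu; apply/polyP=> i; rewrite coef_map coef0; apply: eP; apply: Pu.
  have szh : (1 < size h)%N.
    rewrite ltnNge; apply/negP=> /size1_polyC hE.
    by apply: nPh; rewrite hE lead_coefC /P -hE.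
  have [b /rootP eh0] : exists b, root (map_poly e h) b.
    by apply/closed_rootP; rewrite size_poly_eq ?gtn_eqF.
  have eI u : I u -> (map_poly e u).[b] = 0.
    move=> Iu.
    have [k [q [_ Pr]]] := pseudo_division_mod idI idP Ih nPh minh Iu.
    have /eqP := mapP _ Pr; rewrite rmorphB /= map_polyZ rmorphM rmorphXn /=.
    rewrite subr_eq0 => /eqP/(congr1 (horner^~ b)).
    rewrite hornerZ hornerM eh0 mulr0 => /eqP.
    by rewrite mulf_eq0 expf_eq0 (negPf eh_neq0) andbF => /eqP.
  (* The relation [wE'] is the Bezout relation a = u + q g, evaluated at [b]. *)
  exists b => //; have [u Iu [q wE']] := Jw.
  apply: contraNneq ea_neq0 => eg0.
  have := congr1 (fun p => (map_poly e p).[b]) wE'.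
  rewrite wE rmorphD rmorphM /= map_polyC hornerC hornerD hornerM eg0 mulr0.
  by rewrite eI // addr0 => ->.
have PI u i : I u -> P u`_i.
  move=> Iu.
  apply: (coefs_of_lead_coefs (d := (size u).+1) idI idP) => // r Ir _.
  by apply: boolp.contrapT => nPr; apply: noh; exists r.
(* All of [I] now specializes to zero, so it is enough that some coefficient of [g] survives: then
   any nonroot of the specialized [g] will do. *)
have [i nPgi] : exists i, ~ P g`_i.
  apply: boolp.contrapT => Pg; apply: nIg; apply: ideal_of_coefs => // i.
  by apply: boolp.contrapT => nPgi; apply: Pg; exists i.
exists g`_i => // e eP egi.
have /closed_nonrootP[b gb] : map_poly e g != 0.
  by apply: contraNneq egi => eg0; rewrite -coef_map eg0 coef0.
exists b => // u Iu; have -> : map_poly e u = 0.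
  by apply/polyP=> j; rewrite coef_map coef0 /= eP //; apply: PI.
by rewrite horner0.
Qed.

End PolyExtension.

(** * Hilbert's Nullstellensatz *)

Section Nullstellensatz.
Variable K : closedFieldType.

Definition mpoly_of_poly n : {poly {mpoly K[n]}} -> {mpoly K[n.+1]} :=
  horner_eval 'X_ord_max \o map_poly (@mwiden n K).

HB.instance Definition _ n :=
  GRing.RMorphism.copy (@mpoly_of_poly n)
    (horner_eval 'X_ord_max \o map_poly (@mwiden n K)).

(** This lets a prime ideal in n + 1 variables be studied through its preimage among polynomials in
    the last variable. The image is a subring containing the constants and every variable. *)
Lemma mpoly_of_poly_surj n (p : {mpoly K[n.+1]}) :
  exists q, mpoly_of_poly q = p.
Proof.
have ofX (i : 'I_n.+1) : exists q, mpoly_of_poly q = 'X_i.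
  rewrite /mpoly_of_poly; case: (unliftP ord_max i) => [j ->|->].
    exists ('X_j)%:P; rewrite /= map_polyC /= horner_evalE hornerC.
    rewrite /mwiden mmapX mmap1U; congr 'X_(_).
    by apply/val_inj; rewrite /= /bump leqNgt ltn_ord.
  by exists 'X; rewrite /= map_polyX horner_evalE hornerX.
elim/mpolyind: p => [|c m p _ _ [q <-]]; first by exists 0; rewrite rmorph0.
have [g gX] : exists g : 'I_n.+1 -> _, forall i, mpoly_of_poly (g i) = 'X_i.
  by exists (fun i => sval (boolp.cid (ofX i))) => i; case: boolp.cid.
exists (c%:MP%:P * \prod_i g i ^+ m i + q).
rewrite rmorphD rmorphM rmorph_prod /=; congr (_ + _).
rewrite {1}/mpoly_of_poly /= map_polyC /= horner_evalE hornerC mwidenC.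
rewrite mul_mpolyC mpolyXE_id; congr (_ *: _); apply: eq_bigr => i _.
by rewrite rmorphXn /= gX.
Qed.

Lemma meval_mpoly_of_poly n (v : 'I_n -> K) b (q : {poly {mpoly K[n]}}) :
  (mpoly_of_poly q).@[fun i => oapp v b (unlift ord_max i)]
    = (map_poly (meval v) q).[b].
Proof.
set w := fun i => _.
have wE p : (mwiden p).@[w] = p.@[v].
  elim/mpolyind: p => [|c m p _ _ IHp]; first by rewrite mwiden0 !meval0.
  rewrite mwidenD !mevalD IHp; congr (_ + _).
  rewrite mwidenZ !mevalZ mwidenX !mevalX; congr (_ * _).
  rewrite big_ord_recr /= mnmwiden_ordmax expr0 mulr1; apply: eq_bigr => i _.
  rewrite mnmwiden_widen /w.
  suff -> : widen_ord (leqnSn n) i = lift ord_max i by rewrite liftK.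
  by apply/val_inj; rewrite /= /bump leqNgt ltn_ord.
rewrite /mpoly_of_poly /= horner_evalE -horner_map /= mevalXU /w unlift_none /=.
by congr (_.[_]); rewrite -map_poly_comp; apply: eq_map_poly => p /=; apply: wE.
Qed.

(** Induction on the number of variables. The nonvanishing of [g] is part of the statement because
    the induction hypothesis is applied to the element [a] supplied by [prime_ideal_extension],
    whose nonvanishing lets the point extend. *)
Lemma prime_ideal_point n (Q : {mpoly K[n]} -> Prop) g :
    is_prime_ideal Q -> ~ Q g ->
  exists2 v, g.@[v] != 0 & forall p, Q p -> p.@[v] = 0.
Proof.
elim: n Q g => [|n IHn] Q g prQ nQg; have idQ := prime_ideal prQ.
  (* Without variables all polynomials are constant, and a nonzero constant in [Q] would be
     invertible and force [g] into [Q]. *)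
  exists (fun=> 0) => [|p].
    apply: contra_notN nQg; rewrite [g]nvar0_mpolyC mevalC => /eqP->.
    by rewrite mpolyC0; apply: ideal0.
  rewrite [p]nvar0_mpolyC mevalC => Qc; apply/eqP; apply: contra_notT nQg => c0.
  rewrite -[g]mulr1 -[1]mpolyC1 -(mulVf c0) mpolyCM mulrA.
  exact: idealMl.
move: nQg; have [h <-] := mpoly_of_poly_surj g => nQg.
pose I q := Q (mpoly_of_poly q).
have prI : is_prime_ideal I.
  split; [split|..]; rewrite /I.
  - by rewrite rmorph0; apply: ideal0.
  - by move=> x y; rewrite rmorphD; apply: idealD.
  - by move=> c x; rewrite rmorphM; apply: idealMl.
  - by rewrite rmorph1; apply: prime_ideal1.
  - by move=> x y; rewrite rmorphM; apply: prime_idealM.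
have [a nPa ext] := prime_ideal_extension K prI nQg.
have prP : is_prime_ideal (fun c => I c%:P).
  split; [split|..].
  - by rewrite polyC0; apply: ideal0 (prime_ideal prI).
  - by move=> x y; rewrite polyCD; apply: idealD (prime_ideal prI) _ _.
  - by move=> c x; rewrite polyCM; apply: idealMl (prime_ideal prI) _ _.
  - by rewrite polyC1; apply: prime_ideal1 prI.
  - by move=> x y; rewrite polyCM; apply: prime_idealM prI _ _.
have [v av Pv] := IHn _ a prP nPa.
have [b hb Ib] := ext (meval v) Pv av.
exists (fun i => oapp v b (unlift ord_max i)).
  by rewrite meval_mpoly_of_poly.
move=> p; have [q <-] := mpoly_of_poly_surj p => Iq.
by rewrite meval_mpoly_of_poly Ib.
Qed.

Theorem nullstellensatz n (S : {mpoly K[n]} -> Prop) g :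
    (forall v, (forall p, S p -> p.@[v] = 0) -> g.@[v] = 0) ->
  radical (ideal_gen S) g.
Proof.
move=> vanish; have idS := ideal_gen_ideal S.
apply: boolp.contrapT => nrad.
have [m Sgm|Q [prQ sSQ nQg]] := @prime_ideal_avoiding _ (ideal_gen S) g idS.
  (* [radical] asks for a positive exponent, while [m] may be 0. *)
  by apply: nrad; exists m.+1 => //; rewrite exprS; apply: idealMl.
have [v gv Qv] := prime_ideal_point prQ nQg.
move/eqP: gv; apply; apply: vanish => p Sp.
by apply: Qv; apply: sSQ; apply: mem_ideal_gen.
Qed.

End Nullstellensatz.

(** * Evaluation of ideals, radicals and matrix substitutions *)

Lemma meval_radical (R : idomainType) n (I : {mpoly R[n]} -> Prop) v p :
  (forall q, I q -> q.@[v] = 0) -> radical I p -> p.@[v] = 0.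
Proof.
move=> Iv [m m_gt0 /Iv]; rewrite rmorphXn /= => /eqP.
by rewrite expf_eq0 m_gt0 => /eqP.
Qed.

Lemma meval_ideal_gen (R : comNzRingType) n (S : {mpoly R[n]} -> Prop) v :
  (forall q, S q -> q.@[v] = 0) -> forall q, ideal_gen S q -> q.@[v] = 0.
Proof.
move=> Sv; apply: ideal_gen_sub => //; split=> [|x y x0 y0|c x x0].
- exact: meval0.
- by rewrite mevalD x0 y0 addr0.
- by rewrite mevalM x0 mulr0.
Qed.

Lemma meval_subst_mx (K : fieldType) n N (p : {mpoly K[n * n]})
    (M : 'M[{mpoly K[N]}]_n) v :
  (subst_mx p M).@[v] = eval_mx p (map_mx (meval v) M).
Proof.
rewrite comp_mpoly_meval; apply: meval_eq => k.
by rewrite tnth_mktuple -map_mxvec mxE.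
Qed.

(** * The zeros of [Ihat] and [Ihat_xy] in terms of matrices *)

Section Points.
Variables (K : fieldType) (n r : nat) (f : 'I_r -> {mpoly K[n * n]}).
Implicit Types (v : 'I_(nhat n) -> K) (w : 'I_(nhat n + nhat n) -> K).

Definition point_mx v : 'M[K]_n := map_mx (meval v) (xmx K n).

(** These are the zeros of [Ihat]; the last equation is $f_0 = 0$, which forces invertibility. *)
Definition Vhat v : Prop := V f (point_mx v) /\ v ord0 * \det (point_mx v) = 1.

Lemma point_mx_unit v : Vhat v -> point_mx v \in unitmx.
Proof.
case=> _ vdet; rewrite unitmxE unitfE.
by apply: contra_eq_neq vdet => ->; rewrite mulr0 eq_sym oner_neq0.
Qed.

Lemma Vhat_Vstar v : Vhat v -> Vstar f (point_mx v).
Proof. by move=> vV; split; [case: vV | apply: point_mx_unit]. Qed.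

Lemma Vstar_Vhat A : Vstar f A -> exists2 v, Vhat v & point_mx v = A.
Proof.
case=> VA uA.
exists (fun k => oapp (fun j => mxvec A 0 j) (\det A)^-1 (unlift ord0 k)).
  rewrite /Vhat; set v := fun k => _.
  suff -> : point_mx v = A.
    by split=> //; rewrite /v unlift_none /= mulVr // -unitmxE.
  by apply/matrixP=> i j; rewrite !mxE mevalXU /v liftK /= mxvecE.
by apply/matrixP=> i j; rewrite !mxE mevalXU liftK /= mxvecE.
Qed.

Lemma meval_Ihat_gens v :
  (forall q, (exists i, q = subst_mx (f i) (xmx K n)) \/ q = f0 K n ->
     q.@[v] = 0) <-> Vhat v.
Proof.
have f0v : (f0 K n).@[v] = v ord0 * \det (point_mx v) - 1.
  by rewrite mevalB meval1 mevalM mevalXU det_map_mx.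
split=> [v0|[Vv vdet] q].
  split=> [i|]; last by apply/eqP; rewrite -subr_eq0 -f0v v0 //; right.
  by rewrite -meval_subst_mx v0 //; left; exists i.
by case=> [[i ->]|->]; rewrite ?f0v ?vdet ?subrr // meval_subst_mx.
Qed.

Lemma meval_Ihat v : (forall q, Ihat f q -> q.@[v] = 0) <-> Vhat v.
Proof.
split=> [v0|/meval_Ihat_gens]; last exact: meval_ideal_gen.
by apply/meval_Ihat_gens => q Sq; apply: v0; apply: mem_ideal_gen.
Qed.

(** At a zero of [Ihat] the variable $x_0$ takes the value $1/\det(x)$, so $x_0\,\mathrm{adj}(x)$ is
    the adjoint formula for the inverse. *)
Lemma map_Nmx v : Vhat v -> map_mx (meval v) (Nmx K n) = invmx (point_mx v).
Proof.
move=> Vv; rewrite /invmx point_mx_unit // map_mxZ map_mx_adj /= mevalXU.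
congr (_ *: _); case: Vv => _ vdet.
have d_neq0 : \det (point_mx v) != 0.
  by apply: contra_eq_neq vdet => ->; rewrite mulr0 eq_sym oner_neq0.
by apply: (mulIf d_neq0); rewrite vdet mulVf.
Qed.

Lemma meval_in_x p w : (in_x p).@[w] = p.@[fun k => w (lshift _ k)].
Proof.
rewrite comp_mpoly_meval; apply: meval_eq => k.
by rewrite tnth_mktuple mevalXU.
Qed.

Lemma meval_in_y p w : (in_y p).@[w] = p.@[fun k => w (rshift _ k)].
Proof.
rewrite comp_mpoly_meval; apply: meval_eq => k.
by rewrite tnth_mktuple mevalXU.
Qed.

Lemma map_xymx w :
  map_mx (meval w) (xymx K n)
    = point_mx (fun k => w (lshift _ k)) *m point_mx (fun k => w (rshift _ k)).
Proof.
rewrite map_mxM -!map_mx_comp; congr (_ *m _); apply/matrixP=> i j.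
  by rewrite [LHS]mxE [RHS]mxE; apply: meval_in_x.
by rewrite [LHS]mxE [RHS]mxE; apply: meval_in_y.
Qed.

Lemma meval_Ihat_xy_gens w :
  (forall q, (exists2 p, Ihat f p & q = in_x p \/ q = in_y p) -> q.@[w] = 0)
  <-> Vhat (fun k => w (lshift _ k)) /\ Vhat (fun k => w (rshift _ k)).
Proof.
rewrite -!meval_Ihat; split=> [w0|[x0 y0] q [p Ip]].
  split=> p Ip.
    by rewrite -meval_in_x w0 //; exists p => //; left.
  by rewrite -meval_in_y w0 //; exists p => //; right.
by case=> ->; rewrite ?meval_in_x ?meval_in_y; [apply: x0 | apply: y0].
Qed.

Lemma meval_radical_Ihat p v : radical (Ihat f) p -> Vhat v -> p.@[v] = 0.
Proof. by move=> rad_p /meval_Ihat v0; apply: meval_radical rad_p. Qed.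

(** Two zeros of [Ihat], each filling one block of variables, glue to a zero of [Ihat_xy]. *)
Lemma meval_radical_Ihat_xy p v1 v2 :
    radical (Ihat_xy f) p -> Vhat v1 -> Vhat v2 ->
  p.@[fun k => match split k with inl i => v1 i | inr i => v2 i end] = 0.
Proof.
move=> rad_p V1 V2; set w := fun k => _.
have wx : (fun k => w (lshift _ k)) =1 v1.
  by move=> k; rewrite /w (unsplitK (inl k)).
have wy : (fun k => w (rshift _ k)) =1 v2.
  by move=> k; rewrite /w (unsplitK (inr k)).
apply: meval_radical rad_p; apply: meval_ideal_gen => _ [q Iq [->|->]].
  by rewrite meval_in_x (meval_eq _ wx); apply: (proj2 (meval_Ihat v1)).
by rewrite meval_in_y (meval_eq _ wy); apply: (proj2 (meval_Ihat v2)).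
Qed.

End Points.

(** * The group criterion and the algorithm *)

Section GroupCriterion.
Variables (K : closedFieldType) (n r : nat) (f : 'I_r -> {mpoly K[n * n]}).

Lemma radical_IhatP p :
  (forall v, Vhat f v -> p.@[v] = 0) <-> radical (Ihat f) p.
Proof.
split=> [v0|rad_p v]; last exact: meval_radical_Ihat.
by apply: nullstellensatz => v /meval_Ihat_gens; apply: v0.
Qed.

Lemma radical_Ihat_xyP p :
  (forall w, Vhat f (fun k => w (lshift _ k)) ->
     Vhat f (fun k => w (rshift _ k)) -> p.@[w] = 0) ->
  radical (Ihat_xy f) p.
Proof.
by move=> w0; apply: nullstellensatz => w /meval_Ihat_xy_gens[]; apply: w0.
Qed.

(** Forward, the Nullstellensatz turns vanishing into radical membership; backward, the memberships
    are evaluated at points lying over the given matrices. *)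
Lemma subgroup_GL_VstarP :
  is_subgroup_GL (Vstar f) <->
  forall i : 'I_r,
    [/\ eval_mx (f i) 1%:M = 0,
        radical (Ihat f) (subst_mx (f i) (Nmx K n))
      & radical (Ihat_xy f) (subst_mx (f i) (xymx K n))].
Proof.
split=> [[_ [V1 _] VM VV] i|crit].
  split=> //.
    apply/radical_IhatP => v Vv; rewrite meval_subst_mx (map_Nmx Vv).
    by have [] := VV _ (Vhat_Vstar Vv).
  apply: radical_Ihat_xyP => w Vx Vy; rewrite meval_subst_mx map_xymx.
  by have [] := VM _ _ (Vhat_Vstar Vx) (Vhat_Vstar Vy).
split=> [A []//||A B|A].
- by split; [move=> i; case: (crit i) | apply: unitmx1].
- move=> VA VB; split; last by rewrite unitmx_mul; case: VA VB => _ -> [].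
  case/Vstar_Vhat: VA => v1 V1 <-; case/Vstar_Vhat: VB => v2 V2 <- i.
  have [_ _ /meval_radical_Ihat_xy/(_ V1 V2)] := crit i.
  rewrite meval_subst_mx map_xymx; congr (eval_mx _ (_ *m _) = 0).
    by apply/matrixP=> j k; rewrite !mxE !mevalXU (unsplitK (inl _)).
  by apply/matrixP=> j k; rewrite !mxE !mevalXU (unsplitK (inr _)).
- move=> VA; split; last by rewrite unitmx_inv; case: VA.
  case/Vstar_Vhat: VA => v Vv <- i.
  have [_ /meval_radical_Ihat/(_ Vv) + _] := crit i.
  by rewrite meval_subst_mx (map_Nmx Vv).
Qed.

Lemma check_loopP (in_rad_hat : pred {mpoly K[nhat n]})
    (in_rad_xy : pred {mpoly K[nhat n + nhat n]}) (s : seq 'I_r) :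
  check_loop f in_rad_hat in_rad_xy s
    = all (fun i => [&& eval_mx (f i) 1%:M == 0,
                        in_rad_hat (subst_mx (f i) (Nmx K n))
                      & in_rad_xy (subst_mx (f i) (xymx K n))]) s.
Proof.
elim: s => //= i s ->.
by case: (_ == 0); case: (in_rad_hat _); case: (in_rad_xy _).
Qed.

End GroupCriterion.

Theorem mainTheorem1 (K : closedFieldType) (n r : nat) (n_gt0 : (0 < n)%N)
    (f : 'I_r -> {mpoly K[n * n]}) :
  (forall (in_rad_hat : {mpoly K[nhat n]} -> bool)
          (in_rad_xy : {mpoly K[nhat n + nhat n]} -> bool),
     (forall p, reflect (radical (Ihat f) p) (in_rad_hat p)) ->
     (forall p, reflect (radical (Ihat_xy f) p) (in_rad_xy p)) ->
     group_test f in_rad_hat in_rad_xy = true <-> is_subgroup_GL (Vstar f))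
  /\
  (is_subgroup_GL (Vstar f) <->
   forall i : 'I_r,
     [/\ eval_mx (f i) 1%:M = 0,
         radical (Ihat f) (subst_mx (f i) (Nmx K n))
       & radical (Ihat_xy f) (subst_mx (f i) (xymx K n))]).
Proof.
split=> [in_rad_hat in_rad_xy hatP xyP|]; last exact: subgroup_GL_VstarP.
(* Correct subroutines turn the boolean tests into the memberships of the criterion, and [enum]
   lists every index. *)
rewrite subgroup_GL_VstarP /group_test check_loopP.
split=> [/allP test i|crit].
  by have /and3P[/eqP ? /hatP ? /xyP ?] := test i (mem_enum _ i).
apply/allP=> i _; have [e1 /hatP ? /xyP ?] := crit i.
by apply/and3P; split=> //; apply/eqP.
Qed.
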